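(* Let $(A,\mu_{\alpha,\beta},R_\omega,p_\omega,q_\omega)_{\alpha,\beta,\omega\in\Omega}$ be a Rota-Baxter family BiHom-$\Omega$-associative algebra of weight $\lambda$. If $(\mu^t_{\alpha,\beta},R^t_\omega)_{\alpha,\beta,\omega\in\Omega}$ and $(\bar\mu^t_{\alpha,\beta},\bar R^t_\omega)_{\alpha,\beta,\omega\in\Omega}$ are two equivalent 1-parameter formal deformations of $A$, then their infinitesimals $(\mu^1_{\alpha,\beta},R^1_\omega)_{\alpha,\beta,\omega\in\Omega}$ and $(\bar\mu^1_{\alpha,\beta},\bar R^1_\omega)_{\alpha,\beta,\omega\in\Omega}$ are in the same cohomology class in $\mathrm{H}^\bullet_{\mathrm{RBFA}_\lambda}(A)$ (that is, in degree $2$).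
   Context: $\mathbf{k}$ is a commutative unitary ring (the base ring for all vector spaces and linear maps), $\lambda\in\mathbf{k}$, and $\Omega$ is a semigroup with unit $1$. Two families of linear endomorphisms $(p_\omega),(q_\omega)$ are commuting if $p_\alpha\circ q_\beta=q_\beta\circ p_\alpha$ for all $\alpha,\beta\in\Omega$. A BiHom-$\Omega$-associative algebra $(A,\mu_{\alpha,\beta},p_\omega,q_\omega)$ is a vector space $A$ with two commuting families of linear maps $p_\omega,q_\omega:A\to A$ and bilinear maps $\mu_{\alpha,\beta}:A\otimes A\to A$ such that for all $x,y,z\in A$, $\alpha,\beta,\gamma\in\Omega$: $p_{\alpha\beta}\mu_{\alpha,\beta}(x,y)=\mu_{\alpha,\beta}(p_\alpha(x),p_\beta(y))$, $q_{\alpha\beta}\mu_{\alpha,\beta}(x,y)=\mu_{\alpha,\beta}(q_\alpha(x),q_\beta(y))$, $\mu_{\alpha,\beta\gamma}(p_\alpha(x),\mu_{\beta,\gamma}(y,z))=\mu_{\alpha\beta,\gamma}(\mu_{\alpha,\beta}(x,y),q_\gamma(z))$. It is a Rota-Baxter family BiHom-$\Omega$-associative algebra of weight $\lambda$ when equipped with linear maps $R_\omega:A\to A$ with $p_\alpha R_\alpha=R_\alpha p_\alpha$, $q_\alpha R_\alpha=R_\alpha q_\alpha$, and $\mu_{\alpha,\beta}(R_\alpha(x),R_\beta(y))=R_{\alpha\beta}\big(\mu_{\alpha,\beta}(R_\alpha(x),y)+\mu_{\alpha,\beta}(x,R_\beta(y))+\lambda\mu_{\alpha,\beta}(x,y)\big)$.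 Cochains: $\mathrm{C}^0_\Omega(A)=\mathrm{C}^0_{\mathrm{RBF}_\lambda}(A)=\{x\in A: p_1(x)=x=q_1(x)\}$; $\mathrm{C}^1_\Omega(A)=\mathrm{C}^1_{\mathrm{RBF}_\lambda}(A)$ is the space of families of linear maps $f_\alpha:A\to A$ with $p_\alpha f_\alpha=f_\alpha p_\alpha$, $q_\alpha f_\alpha=f_\alpha q_\alpha$; $\mathrm{C}^2_\Omega(A)$ is the space of families of bilinear maps $f_{\alpha,\beta}:A\otimes A\to A$ with $p_{\alpha\beta}f_{\alpha,\beta}=f_{\alpha,\beta}(p_\alpha\otimes p_\beta)$, $q_{\alpha\beta}f_{\alpha,\beta}=f_{\alpha,\beta}(q_\alpha\otimes q_\beta)$. Put $\mathrm{C}^n_{\mathrm{RBFA}_\lambda}(A)=\mathrm{C}^n_\Omega(A)\oplus\mathrm{C}^{n-1}_{\mathrm{RBF}_\lambda}(A)$ for $n\ge1$, with $d^1(f,x)=(\delta^1_{\mathrm{Alg}}f,-\partial^0x-\Phi^1f)$ and $d^2(f,h)=(\delta^2_{\mathrm{Alg}}f,-\partial^1h-\Phi^2f)$, where $(\delta^1_{\mathrm{Alg}}f)_{\alpha,\beta}(a,b)=\mu_{\alpha,\beta}(a,f_\beta(b))-f_{\alpha\beta}(\mu_{\alpha,\beta}(a,b))+\mu_{\alpha,\beta}(f_\alpha(a),b)$; $(\delta^2_{\mathrm{Alg}}f)_{\alpha,\beta,\gamma}(a,b,c)=\mu_{\alpha,\beta\gamma}(p_\alpha(a),f_{\beta,\gamma}(b,c))-f_{\alpha\beta,\gamma}(\mu_{\alpha,\beta}(a,b),q_\gamma(c))+f_{\alpha,\beta\gamma}(p_\alpha(a),\mu_{\beta,\gamma}(b,c))-\mu_{\alpha\beta,\gamma}(f_{\alpha,\beta}(a,b),q_\gamma(c))$;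 $(\partial^0x)_\alpha(a)=\mu_{\alpha,1}(R_\alpha(a),x)-R_\alpha\mu_{\alpha,1}(a,x)-\mu_{1,\alpha}(x,R_\alpha(a))+R_\alpha\mu_{1,\alpha}(x,a)$; $(\partial^1h)_{\alpha,\beta}(a,b)=\mu_{\alpha,\beta}(R_\alpha(a),h_\beta(b))-R_{\alpha\beta}\mu_{\alpha,\beta}(a,h_\beta(b))-h_{\alpha\beta}\big(\mu_{\alpha,\beta}(a,R_\beta(b))+\mu_{\alpha,\beta}(R_\alpha(a),b)+\lambda\mu_{\alpha,\beta}(a,b)\big)+\mu_{\alpha,\beta}(h_\alpha(a),R_\beta(b))-R_{\alpha\beta}\mu_{\alpha,\beta}(h_\alpha(a),b)$; $(\Phi^1f)_\alpha(a)=f_\alpha(R_\alpha(a))-R_\alpha(f_\alpha(a))$; $(\Phi^2f)_{\alpha,\beta}(a,b)=f_{\alpha,\beta}(R_\alpha(a),R_\beta(b))-R_{\alpha\beta}\big(\lambda f_{\alpha,\beta}(a,b)+f_{\alpha,\beta}(R_\alpha(a),b)+f_{\alpha,\beta}(a,R_\beta(b))\big)$. 2-cocycles are elements of $\mathrm{Ker}\,d^2$, 2-coboundaries are elements of $\mathrm{Im}\,d^1$, and $\mathrm{H}^2_{\mathrm{RBFA}_\lambda}(A)=\mathrm{Ker}\,d^2/\mathrm{Im}\,d^1$; two 2-cocycles are in the same cohomology class if their difference lies in $\mathrm{Im}\,d^1$. A 1-parameter formal deformation of $A$ is a pair of families of power series $\mu^t_{\alpha,\beta}=\sum_{i\ge0}\mu^i_{\alpha,\beta}t^i$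 with $(\mu^i_{\alpha,\beta})\in\mathrm{C}^2_\Omega(A)$ and $R^t_\omega=\sum_{i\ge0}R^i_\omega t^i$ with $(R^i_\omega)\in\mathrm{C}^1_{\mathrm{RBF}_\lambda}(A)$, such that $\mu^0_{\alpha,\beta}=\mu_{\alpha,\beta}$, $R^0_\omega=R_\omega$ and $(A[[t]],\mu^t_{\alpha,\beta},R^t_\omega,p_\omega,q_\omega)$ is a Rota-Baxter family BiHom-$\Omega$-associative algebra of weight $\lambda$ over $\mathbf{k}[[t]]$ (maps extended $\mathbf{k}[[t]]$-linearly). Its infinitesimal is $(\mu^1_{\alpha,\beta},R^1_\omega)$, which is a 2-cocycle. Two such deformations $(\mu^t,R^t)$, $(\bar\mu^t,\bar R^t)$ are equivalent if there are power series $\psi^t_\omega=\sum_{i\ge0}\psi^i_\omega t^i:A[[t]]\to A[[t]]$, with $\psi^i_\omega:A\to A$ linear and $\psi^0_\omega=\mathrm{id}_A$, such that $\psi^t_\omega p_\omega=p_\omega\psi^t_\omega$, $\psi^t_\omega q_\omega=q_\omega\psi^t_\omega$, $\psi^t_{\alpha\beta}\circ\bar\mu^t_{\alpha,\beta}=\mu^t_{\alpha,\beta}\circ(\psi^t_\alpha\otimes\psi^t_\beta)$ and $\psi^t_\omega\circ\bar R^t_\omega=R^t_\omega\circ\psi^t_\omega$ for all $\alpha,\beta,\omega\in\Omega$. *)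

(* Defs.v *)
From HB Require Import structures.
From mathcomp Require Import all_boot all_algebra.
From mathcomp Require Import boolp classical_sets functions.

Set Implicit Arguments.
Unset Strict Implicit.
Unset Printing Implicit Defensive.

Import GRing.Theory.
Local Open Scope classical_set_scope.
Local Open Scope ring_scope.

(* [pseries T] is T[[t]]; a wrapper rather than [nat -> T] itself because
   function types already carry the pointwise ring structure. *)
Record pseries (T : Type) := PSeries { pscoef : nat -> T }.

Lemma pseriesP (T : Type) (x y : pseries T) :
  (forall n, pscoef x n = pscoef y n) -> x = y.
Proof. by case: x y => [x] [y] /= xy; congr PSeries; apply/funext. Qed.

HB.instance Definition _ (T : Type) := gen_eqMixin (pseries T).
HB.instance Definition _ (T : Type) := gen_choiceMixin (pseries T).

Section PSeriesZmod.
Variable V : zmodType.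
Implicit Types x y z : pseries V.

Definition ps_add x y := PSeries (fun n => pscoef x n + pscoef y n).
Definition ps_opp x := PSeries (fun n => - pscoef x n).
Definition ps_zero : pseries V := PSeries (fun=> 0).

Fact ps_addA : associative ps_add.
Proof. by move=> x y z; apply: pseriesP => n; apply: addrA. Qed.
Fact ps_addC : commutative ps_add.
Proof. by move=> x y; apply: pseriesP => n; apply: addrC. Qed.
Fact ps_add0 : left_id ps_zero ps_add.
Proof. by move=> x; apply: pseriesP => n; apply: add0r. Qed.
Fact ps_addN : left_inverse ps_zero ps_opp ps_add.
Proof. by move=> x; apply: pseriesP => n; apply: addNr. Qed.

HB.instance Definition _ := GRing.isZmodule.Build (pseries V)
  ps_addA ps_addC ps_add0 ps_addN.

End PSeriesZmod.

Section CauchyProduct.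
Variables (k : comPzRingType) (V : lmodType k).
Implicit Types (a b : pseries k) (x y : pseries V).

Definition ps_scale a x : pseries V :=
  PSeries (fun n => \sum_(i < n.+1) pscoef a i *: pscoef x (n - i)%N).

Definition psC (T : zmodType) (c : T) : pseries T :=
  PSeries (fun n => if n == 0%N then c else 0).

Fact ps_scale1 : left_id (psC (1 : k)) ps_scale.
Proof.
move=> x; apply: pseriesP => n /=.
rewrite big_ord_recl /= scale1r subn0 big1 ?addr0 // => i _.
by rewrite scale0r.
Qed.

Fact ps_scaleDr : right_distributive ps_scale +%R.
Proof.
move=> a x y; apply: pseriesP => n /=.
by rewrite -big_split /=; apply: eq_bigr => i _; rewrite scalerDr.
Qed.

Fact ps_scaleDl x : {morph ps_scale^~ x : a b / a + b}.
Proof.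
move=> a b; apply: pseriesP => n /=.
by rewrite -big_split /=; apply: eq_bigr => i _; rewrite scalerDl.
Qed.

End CauchyProduct.

Section PSeriesRing.
Variable k : comPzRingType.
Implicit Types a b c : pseries k.

Definition ps_mul a b : pseries k :=
  PSeries (fun n => \sum_(i < n.+1) pscoef a i * pscoef b (n - i)%N).

Fact ps_scaleA (V : lmodType k) a b (x : pseries V) :
  ps_scale a (ps_scale b x) = ps_scale (ps_mul a b) x.
Proof.
apply: pseriesP => n /=.
pose F i j := pscoef a j *: (pscoef b (i - j)%N *: pscoef x (n - i)%N).
transitivity (\sum_(0 <= i < n.+1) \sum_(0 <= j < n.+1 | (j <= i)%N) F i j).
  rewrite (exchange_big_dep xpredT) //= big_mkord; apply: eq_bigr => j _.
  rewrite [RHS](big_cat_nat (leq0n j) (ltnW (ltn_ord j))) /=.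
  rewrite [X in _ = X + _]big_nat_cond [X in _ = X + _]big1 => [|i]; last first.
    by move=> /andP[/andP[_ ij] ji]; rewrite leqNgt ij in ji.
  have shift m (P : pred nat) (G : nat -> V) :
      \sum_(m <= i < n.+1 | P i) G i =
      \sum_(0 <= i < n.+1 - m | P (i + m)%N) G (i + m)%N.
    by rewrite -big_addn add0n.
  rewrite add0r shift big_mkord.
  rewrite [RHS](eq_bigl xpredT) => [|i]; last by rewrite leq_addl.
  rewrite subSn ?leq_ord // scaler_sumr; apply: eq_bigr => i _.
  by rewrite /F addnK addnC subnDA.
rewrite big_mkord; apply: eq_bigr => i _.
rewrite (big_cat_nat (leq0n i.+1) (ltn_ord i)) /=.
rewrite [X in _ + X]big_nat_cond [X in _ + X]big1 => [|j]; last first.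
  by move=> /andP[/andP[ij _] ji]; rewrite ltnNge ji in ij.
rewrite addr0 big_nat_cond (eq_bigl (fun j => (0 <= j < i.+1)%N)) => [|j].
  rewrite -big_nat big_mkord scaler_suml; apply: eq_bigr => j _.
  by rewrite /F scalerA.
by rewrite /= ltnS andbb.
Qed.

Fact ps_mulA : associative ps_mul.
Proof. by move=> a b c; apply: (@ps_scaleA k^o). Qed.
Fact ps_mulC : commutative ps_mul.
Proof.
move=> a b; apply: pseriesP => n /=.
rewrite (reindex_inj rev_ord_inj) /=; apply: eq_bigr => i _.
by rewrite mulrC subSS subKn // -ltnS.
Qed.
Fact ps_mul1 : left_id (psC (1 : k)) ps_mul.
Proof. by move=> a; apply: (@ps_scale1 _ k^o). Qed.
Fact ps_mulDl : left_distributive ps_mul +%R.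
Proof. by move=> a b c; apply: (@ps_scaleDl _ k^o). Qed.

HB.instance Definition _ := GRing.Zmodule_isComPzRing.Build (pseries k)
  ps_mulA ps_mulC ps_mul1 ps_mulDl.

HB.instance Definition _ (V : lmodType k) :=
  GRing.Zmodule_isLmodule.Build (pseries k) (pseries V)
    (@ps_scaleA V) (@ps_scale1 k V) (@ps_scaleDr k V) (@ps_scaleDl k V).

End PSeriesRing.

(** k[[t]]-linear extensions to A[[t]] of a k-linear map, of a power series of
    linear maps and of a power series of bilinear maps. *)

Definition ps_map (A B : Type) (f : A -> B) (x : pseries A) : pseries B :=
  PSeries (fun n => f (pscoef x n)).

Definition ps_ext1 (A B : zmodType) (f : nat -> A -> B) (x : pseries A) :
    pseries B :=
  PSeries (fun n => \sum_(i < n.+1) f i (pscoef x (n - i)%N)).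

Definition ps_ext2 (A B C : zmodType) (f : nat -> A -> B -> C)
    (x : pseries A) (y : pseries B) : pseries C :=
  PSeries (fun n => \sum_(i < n.+1) \sum_(j < (n - i).+1)
    f i (pscoef x j) (pscoef y (n - i - j)%N)).

(* [bilinear_for] of sesquilinear.v is restricted to nontrivial rings. *)
Definition bilinear_map (K : pzRingType) (U V W : lmodType K)
    (f : U -> V -> W) : Prop :=
  (forall y, linear (f^~ y)) /\ (forall x, linear (f x)).

Section Algebras.
Variables (K : comPzRingType) (Om : monoidType) (A : lmodType K).
Implicit Types (mu : Om -> Om -> A -> A -> A) (R p q : Om -> A -> A).

Record bihom_omega_assoc mu p q : Prop := {
  bihom_p_linear : forall al, linear (p al);
  bihom_q_linear : forall al, linear (q al);
  bihom_mu_bilinear : forall al be, bilinear_map (mu al be);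
  bihom_commuting : forall al be x, p al (q be x) = q be (p al x);
  bihom_p_mu : forall al be x y,
    p (al * be)%g (mu al be x y) = mu al be (p al x) (p be y);
  bihom_q_mu : forall al be x y,
    q (al * be)%g (mu al be x y) = mu al be (q al x) (q be y);
  bihom_assoc : forall al be ga x y z,
    mu al (be * ga)%g (p al x) (mu be ga y z) =
    mu (al * be)%g ga (mu al be x y) (q ga z) }.

Record rota_baxter_family (lambda : K) mu R p q : Prop := {
  rbf_bihom : bihom_omega_assoc mu p q;
  rbf_R_linear : forall al, linear (R al);
  rbf_p_R : forall al x, p al (R al x) = R al (p al x);
  rbf_q_R : forall al x, q al (R al x) = R al (q al x);
  rbf_rota_baxter : forall al be x y,
    mu al be (R al x) (R be y) =
    R (al * be)%g
      (mu al be (R al x) y + mu al be x (R be y) + lambda *: mu al be x y) }.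

End Algebras.

Section Cohomology.
Variables (k : comPzRingType) (lambda : k) (Om : monoidType) (A : lmodType k).
Variables (mu : Om -> Om -> A -> A -> A) (R p q : Om -> A -> A).

(* C^n_Omega(A) and C^n_RBF(A) coincide for n = 0, 1. *)
Definition cochain0 : set A := [set x | p 1%g x = x /\ q 1%g x = x].

Definition cochain1 : set (Om -> A -> A) :=
  [set f | [/\ forall al, linear (f al),
    forall al a, p al (f al a) = f al (p al a) &
    forall al a, q al (f al a) = f al (q al a)]].

Definition cochain2 : set (Om -> Om -> A -> A -> A) :=
  [set f | [/\ forall al be, bilinear_map (f al be),
    forall al be a b, p (al * be)%g (f al be a b) = f al be (p al a) (p be b) &
    forall al be a b, q (al * be)%g (f al be a b) = f al be (q al a) (q be b)]].

Definition rbfa_cochain1 : set ((Om -> A -> A) * A) := cochain1 `*` cochain0.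

Definition rbfa_cochain2 :
  set ((Om -> Om -> A -> A -> A) * (Om -> A -> A)) := cochain2 `*` cochain1.

Definition delta1 (f : Om -> A -> A) : Om -> Om -> A -> A -> A :=
  fun al be a b =>
    mu al be a (f be b) - f (al * be)%g (mu al be a b) + mu al be (f al a) b.

Definition delta2 (f : Om -> Om -> A -> A -> A) :
    Om -> Om -> Om -> A -> A -> A -> A :=
  fun al be ga a b c =>
    mu al (be * ga)%g (p al a) (f be ga b c)
    - f (al * be)%g ga (mu al be a b) (q ga c)
    + f al (be * ga)%g (p al a) (mu be ga b c)
    - mu (al * be)%g ga (f al be a b) (q ga c).

Definition partial0 (x : A) : Om -> A -> A :=
  fun al a =>
    mu al 1%g (R al a) x - R al (mu al 1%g a x)
    - mu 1%g al x (R al a) + R al (mu 1%g al x a).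

Definition partial1 (h : Om -> A -> A) : Om -> Om -> A -> A -> A :=
  fun al be a b =>
    mu al be (R al a) (h be b) - R (al * be)%g (mu al be a (h be b))
    - h (al * be)%g
        (mu al be a (R be b) + mu al be (R al a) b + lambda *: mu al be a b)
    + mu al be (h al a) (R be b) - R (al * be)%g (mu al be (h al a) b).

Definition Phi1 (f : Om -> A -> A) : Om -> A -> A :=
  fun al a => f al (R al a) - R al (f al a).

Definition Phi2 (f : Om -> Om -> A -> A -> A) : Om -> Om -> A -> A -> A :=
  fun al be a b =>
    f al be (R al a) (R be b)
    - R (al * be)%g
        (lambda *: f al be a b + f al be (R al a) b + f al be a (R be b)).

Definition rbfa_d1 (c : (Om -> A -> A) * A) :
    (Om -> Om -> A -> A -> A) * (Om -> A -> A) :=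
  (delta1 c.1, - partial0 c.2 - Phi1 c.1).

Definition rbfa_d2 (c : (Om -> Om -> A -> A -> A) * (Om -> A -> A)) :
    (Om -> Om -> Om -> A -> A -> A -> A) * (Om -> Om -> A -> A -> A) :=
  (delta2 c.1, - partial1 c.2 - Phi2 c.1).

Definition rbfa_cocycle2 : set ((Om -> Om -> A -> A -> A) * (Om -> A -> A)) :=
  [set c | rbfa_cochain2 c /\ rbfa_d2 c = 0].

Definition rbfa_coboundary2 :
  set ((Om -> Om -> A -> A -> A) * (Om -> A -> A)) :=
  rbfa_d1 @` rbfa_cochain1.

(* Equality of the classes of [c] and [c'] in H^2 = Ker d^2 / Im d^1; that the
   classes exist, i.e. that [c] and [c'] are 2-cocycles, is part of it. *)
Definition same_class2 (c c' : (Om -> Om -> A -> A -> A) * (Om -> A -> A)) :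
    Prop :=
  [/\ rbfa_cocycle2 c, rbfa_cocycle2 c' & rbfa_coboundary2 (c - c')].

End Cohomology.

Section Deformations.
Variables (k : comPzRingType) (lambda : k) (Om : monoidType) (A : lmodType k).
Variables (mu : Om -> Om -> A -> A -> A) (R p q : Om -> A -> A).
Implicit Types (mut : nat -> Om -> Om -> A -> A -> A) (Rt : nat -> Om -> A -> A).

(* [mut i] and [Rt i] are the coefficients mu^i and R^i of t^i. *)
Record formal_deformation mut Rt : Prop := {
  def_mu_cochain : forall i, cochain2 p q (mut i);
  def_R_cochain : forall i, cochain1 p q (Rt i);
  def_mu0 : mut 0%N = mu;
  def_R0 : Rt 0%N = R;
  def_rbf : rota_baxter_family (psC lambda)
    (fun al be => ps_ext2 (fun i => mut i al be))
    (fun om => ps_ext1 (fun i => Rt i om))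
    (fun om => ps_map (p om)) (fun om => ps_map (q om)) }.

Definition infinitesimal mut Rt :
    (Om -> Om -> A -> A -> A) * (Om -> A -> A) :=
  (mut 1%N, Rt 1%N).

Definition equivalent_deformations mut Rt mut' Rt' : Prop :=
  exists psi : nat -> Om -> A -> A,
    let psit om := ps_ext1 (fun i => psi i om) in
    [/\ (forall i om, linear (psi i om)) /\ (forall om, psi 0%N om = id),
      forall om x, psit om (ps_map (p om) x) = ps_map (p om) (psit om x),
      forall om x, psit om (ps_map (q om) x) = ps_map (q om) (psit om x),
      forall al be x y,
        psit (al * be)%g (ps_ext2 (fun i => mut' i al be) x y) =
        ps_ext2 (fun i => mut i al be) (psit al x) (psit be y) &
      forall om x,
        psit om (ps_ext1 (fun i => Rt' i om) x) =
        ps_ext1 (fun i => Rt i om) (psit om x)].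

End Deformations.

(* Main.v *)
Require Import Defs.
From mathcomp Require Import all_boot all_algebra.
From mathcomp Require Import boolp classical_sets functions.

(** Two power series that are equal have the same coefficient of t, and on
    constant series that coefficient involves only the terms of order 0 and 1 of
    the families at hand.  Read in this way, the associativity and Rota-Baxter
    equations of a deformation say that its infinitesimal is killed by
    [rbfa_d2] ([infinitesimal_cocycle2]).

    Let [psi] be an equivalence.  Since [psi 0 = id], the coefficients of t in
    the two intertwining equations give

      mu^1(a, b) - mu'^1(a, b)
        = psi^1(mu(a, b)) - mu(a, psi^1(b)) - mu(psi^1(a), b),
      R^1(a) - R'^1(a) = psi^1(R(a)) - R(psi^1(a)),

    so the difference of the infinitesimals is [rbfa_d1] of the pair
    [(- psi^1, 0)] ([infinitesimal_sub_coboundary2]).  The pair is a cochain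
    because [psi] commutes with the structure maps in each degree.  The sign
    comes from the direction of the equivalence: [psi] carries the primed
    deformation to the other one. *)

Set Implicit Arguments.
Unset Strict Implicit.
Unset Printing Implicit Defensive.

Import GRing.Theory.
Local Open Scope ring_scope.

Section LinearMaps.
Variables (k : comPzRingType) (U V : lmodType k).

Lemma linear_map0 (f : U -> V) : linear f -> f 0 = 0.
Proof. by move=> fL; rewrite -(subrr 0) (zmod_morphism_linear fL) subrr. Qed.

Lemma linear_mapD (f : U -> V) x y : linear f -> f (x + y) = f x + f y.
Proof. by move=> fL; rewrite -[x in LHS]scale1r fL scale1r. Qed.

Lemma linear_mapN (f : U -> V) x : linear f -> f (- x) = - f x.
Proof.
by move=> fL; rewrite -sub0r (zmod_morphism_linear fL) linear_map0 // sub0r.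
Qed.

Lemma linear_opp (f : U -> V) : linear f -> linear (fun x => - f x).
Proof. by move=> fL a x y; rewrite fL opprD scalerN. Qed.

End LinearMaps.

Section BilinearMaps.
Variables (k : comPzRingType) (U V W : lmodType k) (f : U -> V -> W).
Hypothesis f_bilinear : bilinear_map f.

Lemma bilinear_map0l y : f 0 y = 0.
Proof. by case: f_bilinear => fL _; apply: (linear_map0 (fL y)). Qed.

Lemma bilinear_map0r x : f x 0 = 0.
Proof. by case: f_bilinear => _ fL; apply: (linear_map0 (fL x)). Qed.

Lemma bilinear_mapNl x y : f (- x) y = - f x y.
Proof. by case: f_bilinear => fL _; apply: (linear_mapN _ (fL y)). Qed.

Lemma bilinear_mapNr x y : f x (- y) = - f x y.
Proof. by case: f_bilinear => _ fL; apply: (linear_mapN _ (fL x)). Qed.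

End BilinearMaps.

Section Coefficients.
Variables (k : comPzRingType) (U V W : lmodType k).

Lemma pscoefD (x y : pseries V) n :
  pscoef (x + y) n = pscoef x n + pscoef y n.
Proof. by []. Qed.

Lemma ps_scaleC_coef (c : k) (x : pseries V) n :
  pscoef (psC c *: x) n = c *: pscoef x n.
Proof.
rewrite /= big_ord_recl /= subn0 big1 ?addr0 // => i _.
by rewrite scale0r.
Qed.

Lemma ps_mapC (f : U -> V) a : f 0 = 0 -> ps_map f (psC a) = psC (f a).
Proof. by move=> f0; apply: pseriesP => -[|n]. Qed.

(** All the terms of the convolution but the last evaluate a linear map at a
    vanishing coefficient of the constant series. *)
Lemma ps_ext1C (f : nat -> U -> V) a :
  (forall i, linear (f i)) -> ps_ext1 f (psC a) = PSeries (f^~ a).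
Proof.
move=> fL; apply: pseriesP => n /=.
rewrite big_ord_recr /= subnn big1 ?add0r // => i _.
by rewrite subn_eq0 leqNgt ltn_ord /= linear_map0.
Qed.

Lemma ps_ext2C (f : nat -> U -> V -> W) a b :
  (forall i, bilinear_map (f i)) ->
  ps_ext2 f (psC a) (psC b) = PSeries (fun n => f n a b).
Proof.
move=> fL; apply: pseriesP => n /=.
rewrite big_ord_recr /= subnn big_ord1 /= big1 ?add0r // => i _.
rewrite big1 // => -[[|j] j_le] _ /=; last by rewrite bilinear_map0l.
by rewrite subn0 subn_eq0 leqNgt ltn_ord bilinear_map0r.
Qed.

Lemma ps_ext1_coef1 (f : nat -> U -> V) x :
  pscoef (ps_ext1 f x) 1 = f 0%N (pscoef x 1) + f 1%N (pscoef x 0).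
Proof. by rewrite /= big_ord_recl big_ord1. Qed.

Lemma ps_ext2_coef1 (f : nat -> U -> V -> W) x y :
  pscoef (ps_ext2 f x y) 1 =
  f 0%N (pscoef x 0) (pscoef y 1) + f 0%N (pscoef x 1) (pscoef y 0)
  + f 1%N (pscoef x 0) (pscoef y 0).
Proof.
by rewrite /= big_ord_recl big_ord1 /= big_ord1 big_ord_recl big_ord1.
Qed.

End Coefficients.

Section Infinitesimals.
Variables (k : comPzRingType) (lambda : k) (Om : monoidType) (A : lmodType k).
Variables (mu : Om -> Om -> A -> A -> A) (R p q : Om -> A -> A).
Hypothesis A_rbf : rota_baxter_family lambda mu R p q.

Let p0 al : p al 0 = 0.
Proof. exact: linear_map0 (bihom_p_linear (rbf_bihom A_rbf) al). Qed.

Let q0 al : q al 0 = 0.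
Proof. exact: linear_map0 (bihom_q_linear (rbf_bihom A_rbf) al). Qed.

Let muL al be : bilinear_map (mu al be).
Proof. exact: bihom_mu_bilinear (rbf_bihom A_rbf) al be. Qed.

Let RL al : linear (R al).
Proof. exact: rbf_R_linear A_rbf al. Qed.

Lemma partial0_0 : partial0 mu R 0 = 0.
Proof.
apply/funext => al; apply/funext => a; rewrite /partial0.
rewrite !(bilinear_map0l (muL _ _)) !(bilinear_map0r (muL _ _)).
by rewrite (linear_map0 (RL _)) !subr0 addr0.
Qed.

Section Cocycle.
Variables (mut : nat -> Om -> Om -> A -> A -> A) (Rt : nat -> Om -> A -> A).
Hypothesis def : formal_deformation lambda mu R p q mut Rt.

Let mutL i al be : bilinear_map (mut i al be).
Proof. by case: (def_mu_cochain def i). Qed.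

Let RtL i al : linear (Rt i al).
Proof. by case: (def_R_cochain def i). Qed.

(** This is the coefficient of t in BiHom-associativity at three constants: each
    side contributes the two terms in which exactly one of the two products is
    of order 1. *)
Lemma infinitesimal_delta2 : delta2 mu p q (mut 1%N) = 0.
Proof.
apply/funext => al; apply/funext => be; apply/funext => ga.
apply/funext => a; apply/funext => b; apply/funext => c; rewrite /delta2.
have := bihom_assoc (rbf_bihom (def_rbf def)) al be ga (psC a) (psC b) (psC c).
move=> /(congr1 (fun x => pscoef x 1)).
rewrite !ps_mapC // !ps_ext2C // !ps_ext2_coef1 /= (def_mu0 def).
rewrite (bilinear_map0l (muL _ _)) (bilinear_map0r (muL _ _)) addr0 add0r.
move=> assoc1.
by rewrite (addrAC (mu _ _ _ _)) assoc1 addrK subrr.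
Qed.

(** In the coefficient of t of the Rota-Baxter equation at two constants, the
    terms with the product of order 1 form [Phi2] and those with an operator of
    order 1 form [partial1]. *)
Lemma infinitesimal_partial1_Phi2 :
  - partial1 lambda mu R (Rt 1%N) - Phi2 lambda R (mut 1%N) = 0.
Proof.
apply/funext => al; apply/funext => be; apply/funext => a; apply/funext => b.
rewrite -opprD; apply/eqP; rewrite oppr_eq0; apply/eqP.
have := rbf_rota_baxter (def_rbf def) al be (psC a) (psC b).
move=> /(congr1 (fun x => pscoef x 1)).
rewrite !ps_ext1C // ps_ext2C // ps_ext1_coef1 ps_ext2_coef1.
rewrite !pscoefD !ps_scaleC_coef !ps_ext2_coef1 /=.
(* The sums left are coefficients of degree 0. *)
rewrite !big_ord1 /= (def_mu0 def) (def_R0 def).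
rewrite (bilinear_map0l (muL _ _)) (bilinear_map0r (muL _ _)) add0r addr0.
rewrite (addrC (mu al be (R al a) b)) !(linear_mapD _ _ (RL _)).
move=> /eqP; rewrite -subr_eq0 => /eqP rb1.
rewrite -[LHS]/(partial1 _ _ _ _ _ _ _ _ + Phi2 _ _ _ _ _ _ _) -[RHS]rb1.
rewrite /partial1 /Phi2 !(linear_mapD _ _ (RL _)) !opprD !addrA.
(* Both sides are the same nine terms; the order is that of [rb1]. *)
by rewrite [LHS](ACl (1*4*6*5*8*2*9*7*3)).
Qed.

Lemma infinitesimal_cocycle2 :
  rbfa_cocycle2 lambda mu R p q (infinitesimal mut Rt).
Proof.
split; first by split; [apply: (def_mu_cochain def)|apply: (def_R_cochain def)].
by rewrite /rbfa_d2 infinitesimal_delta2 infinitesimal_partial1_Phi2.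
Qed.

End Cocycle.

Section Coboundary.
Variables (mut mut' : nat -> Om -> Om -> A -> A -> A).
Variables (Rt Rt' : nat -> Om -> A -> A).
Hypothesis def : formal_deformation lambda mu R p q mut Rt.
Hypothesis def' : formal_deformation lambda mu R p q mut' Rt'.

(** The degree-one coefficient of the equivalence, with the opposite sign, is a
    primitive of the difference. *)
Lemma infinitesimal_sub_coboundary2 :
  equivalent_deformations p q mut Rt mut' Rt' ->
  rbfa_coboundary2 mu R p q (infinitesimal mut Rt - infinitesimal mut' Rt').
Proof.
have mutL i al be : bilinear_map (mut i al be).
  by case: (def_mu_cochain def i).
have mutL' i al be : bilinear_map (mut' i al be).
  by case: (def_mu_cochain def' i).
have RtL i al : linear (Rt i al) by case: (def_R_cochain def i).
have RtL' i al : linear (Rt' i al) by case: (def_R_cochain def' i).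
case=> psi [[psiL psi0] psi_p psi_q psi_mu psi_R].
exists (fun al a => - psi 1%N al a, 0).
  split; last by split; rewrite /= ?p0 ?q0.
  split=> /= [al|al a|al a]; first exact: linear_opp.
    have := congr1 (fun x => pscoef x 1) (psi_p al (psC a)).
    rewrite ps_mapC // !ps_ext1C //= => ->.
    by rewrite (linear_mapN _ (bihom_p_linear (rbf_bihom A_rbf) al)).
  have := congr1 (fun x => pscoef x 1) (psi_q al (psC a)).
  rewrite ps_mapC // !ps_ext1C //= => ->.
  by rewrite (linear_mapN _ (bihom_q_linear (rbf_bihom A_rbf) al)).
congr pair.
  apply/funext => al; apply/funext => be; apply/funext => a; apply/funext => b.
  have := congr1 (fun x => pscoef x 1) (psi_mu al be (psC a) (psC b)).
  rewrite !ps_ext1C // ps_ext2C // ps_ext1_coef1 ps_ext2_coef1 /=.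
  rewrite !psi0 (def_mu0 def) (def_mu0 def') /=.
  move=> /(canRL (addKr _)) psi_mu1.
  rewrite /delta1 /= (bilinear_mapNl (muL _ _)) (bilinear_mapNr (muL _ _)).
  rewrite -[RHS]/(mut 1%N al be a b - mut' 1%N al be a b) opprK.
  rewrite psi_mu1 !addrA [LHS](ACl ((1*3)*(4*6)*(5*2))) /=.
  by rewrite addNr subrr !add0r.
apply/funext => al; apply/funext => a.
have := congr1 (fun x => pscoef x 1) (psi_R al (psC a)).
rewrite !ps_ext1C // !ps_ext1_coef1 /= psi0 (def_R0 def) (def_R0 def') /=.
move=> /(canRL (addKr _)) psi_R1; rewrite /rbfa_d1 /= partial0_0 oppr0 add0r.
rewrite -[LHS]/(- Phi1 _ _ _ _) -[RHS]/(Rt 1%N al a - Rt' 1%N al a) /Phi1.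
rewrite (linear_mapN _ (RL _)) psi_R1.
by rewrite opprD !opprK -addrA (addrC (R al _)) addrK addrC.
Qed.

End Coboundary.

End Infinitesimals.

Theorem theorem4p11 (k : comPzRingType) (lambda : k) (Om : monoidType)
    (A : lmodType k) (mu : Om -> Om -> A -> A -> A) (R p q : Om -> A -> A)
    (mut mut' : nat -> Om -> Om -> A -> A -> A) (Rt Rt' : nat -> Om -> A -> A) :
  rota_baxter_family lambda mu R p q ->
  formal_deformation lambda mu R p q mut Rt ->
  formal_deformation lambda mu R p q mut' Rt' ->
  equivalent_deformations p q mut Rt mut' Rt' ->
  same_class2 lambda mu R p q (infinitesimal mut Rt) (infinitesimal mut' Rt').
Proof.
move=> A_rbf def def' eqv; split.
- exact: infinitesimal_cocycle2 def.
- exact: infinitesimal_cocycle2 def'.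
- exact: infinitesimal_sub_coboundary2 def def' eqv.
Qed.
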